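(* Let $p,q\in\mathbb{N}$ be co-prime and $\theta=\tan^{-1}(p/q)$. Then $$\mathcal{N}\Big(D,\big\{\tfrac{x+i}{2}: i\in D\big\}\Big)\le P(l_{pq},\sigma|_{l_{pq}},\phi).$$
   Context: Let $D=\{0,1,p/q\}$ with $p/q\in[0,1]$. For $a=a_1\cdots a_n\in D^n$ let $F_a$ be the composition $F_{a_1}\circ\cdots\circ F_{a_n}$ of the maps $F_i(x)=\frac{x+i}{2}$, $i\in D$. Let $\mathcal{N}_n(D)=\#\{(a,b)\in D^n\times D^n: F_a=F_b\}$ (equivalently $\sum_i a_i2^{-i}=\sum_i b_i2^{-i}$), and $\mathcal{N}(D,\{\frac{x+i}{2}:i\in D\})=\lim_{n\to\infty}\frac1n\log\mathcal{N}_n(D)$. Let $B=\{(0,0),(1,0),(0,1),(1,1)\}$ (elements written as column vectors), ordered in this way to index rows/columns $1,2,3,4$. Define the $4\times 4$ matrices $A_{(0,0)}=\begin{pmatrix}3&1&1&1\\0&1&0&0\\0&0&1&0\\0&0&0&1\end{pmatrix}$, $A_{(1,0)}=\begin{pmatrix}1&0&1&0\\1&3&0&1\\0&0&0&0\\0&0&1&1\end{pmatrix}$, $A_{(0,1)}=\begin{pmatrix}1&1&0&0\\0&0&0&0\\1&0&3&1\\0&1&0&1\end{pmatrix}$, $A_{(1,1)}=\begin{pmatrix}1&0&0&0\\0&1&0&0\\0&0&1&0\\1&1&1&3\end{pmatrix}$. For $z\in B^{\mathbb{N}}$ define $$\phi(z)=\limsup_{n\to\infty}\log\frac{(1,1,1,1)A_{z_1}A_{z_2}\cdots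 A_{z_n}(1,0,0,0)^T}{(1,1,1,1)A_{z_2}A_{z_3}\cdots A_{z_n}(1,0,0,0)^T}.$$ For a finite or infinite word $\omega$ over $B$ let $\pi(\omega)=\sum_i\omega_i2^{-i}\in\mathbb{R}^2$. The extended line is $l_\theta=l_{pq}=\{(x,y): \exists x',y' \text{ with } x\equiv x',\ y\equiv y' \pmod 1,\ \tfrac pq x'=y'\}$. Let $X_\theta^n=\{x\in B^n:\pi(x)\in l_\theta\}$ and $X_\theta^{\mathbb{N}}=\{\omega\in B^{\mathbb{N}}:\pi(\omega)\in l_\theta\}$, with left shift $\sigma$. For $i_1\cdots i_n\in X^n_\theta$ let $[i_1\cdots i_n]$ be the set of $\omega\in X^{\mathbb{N}}_\theta$ with $\omega_1\cdots\omega_n=i_1\cdots i_n$. The pressure is $$P(l_{pq},\sigma|_{l_{pq}},\phi)=P(X^{\mathbb{N}}_\theta,\sigma,\phi)=\lim_{n\to\infty}\frac1n\log\Big(\sum_{i_1\cdots i_n\in X^n_\theta}\exp\Big(\sup_{\omega\in[i_1\cdots i_n]}\sum_{j=0}^{n-1}\phi(\sigma^j\omega)\Big)\Big).$$ (Via the binary coding this is the pressure of $\phi$ for the doubling map $T(x,y)=(2x\bmod1,2y\bmod1)$ restricted to $l_{pq}$, also written $P(l_{pq},T|_{l_{pq}},\phi)$.) *)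

(* Defs.v *)
From HB Require Import structures.
From mathcomp Require Import all_boot all_order all_algebra.
From mathcomp Require Import all_classical all_reals all_analysis.
Unset Printing Implicit Defensive.
Import Order.TTheory GRing.Theory Num.Theory.
Import numFieldNormedType.Exports.
Local Open Scope ring_scope.
Local Open Scope classical_set_scope.

(* D = {0, 1, p/q} as a (finite) set of rationals; seq_sub keeps each element once *)
Definition Dseq (p q : nat) : seq rat := [:: 0; 1; (p%:Q / q%:Q)].
Definition Dty (p q : nat) : finType := seq_sub (Dseq p q).

Definition digsum {p q n : nat} (a : {ffun 'I_n -> Dty p q}) : rat :=
  \sum_(i < n) ssval (a i) / 2%:Q ^+ i.+1.

Definition NnD (p q n : nat) : nat :=
  #|[set ab : {ffun 'I_n -> Dty p q} * {ffun 'I_n -> Dty p q} |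
      digsum ab.1 == digsum ab.2]|.

Definition ND (R : realType) (p q : nat) : R :=
  limn (fun n : nat => (n%:R)^-1 * ln ((NnD p q n)%:R : R)).

Definition Bty := (bool * bool)%type.

(* rows/columns ordered (0,0),(1,0),(0,1),(1,1) *)
Definition Bidx (b : Bty) : nat :=
  match b with
  | (false, false) => 0 | (true, false) => 1 | (false, true) => 2 | (true, true) => 3
  end.

Definition Arows (b : Bty) : seq (seq nat) :=
  match b with
  | (false, false) => [:: [:: 3; 1; 1; 1]; [:: 0; 1; 0; 0]; [:: 0; 0; 1; 0]; [:: 0; 0; 0; 1]]
  | (true, false)  => [:: [:: 1; 0; 1; 0]; [:: 1; 3; 0; 1]; [:: 0; 0; 0; 0]; [:: 0; 0; 1; 1]]
  | (false, true)  => [:: [:: 1; 1; 0; 0]; [:: 0; 0; 0; 0]; [:: 1; 0; 3; 1]; [:: 0; 1; 0; 1]]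
  | (true, true)   => [:: [:: 1; 0; 0; 0]; [:: 0; 1; 0; 0]; [:: 0; 0; 1; 0]; [:: 1; 1; 1; 3]]
  end.

Definition Amat (R : realType) (b : Bty) : 'M[R]_4 :=
  \matrix_(i < 4, j < 4) ((nth 0 (nth [::] (Arows b) i) j)%:R : R).

(* (1,1,1,1) A_{z_1} ... A_{z_n} (1,0,0,0)^T, with z_1 = z 0 *)
Definition Mprod (R : realType) (z : nat -> Bty) (n : nat) : R :=
  ((const_mx 1 : 'rV[R]_4) *m (\prod_(i < n) Amat R (z i))
     *m (\col_(j < 4) ((j == 0 :> nat)%:R : R))) 0 0.

Definition shift (z : nat -> Bty) : nat -> Bty := fun k => z k.+1.

Definition phi (R : realType) (z : nat -> Bty) : R :=
  limn_sup (fun n : nat => ln (Mprod R z n / Mprod R (shift z) n.-1)).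

Definition b2R (R : realType) (b : bool) : R := (b : nat)%:R.

Definition piFin (R : realType) {n : nat} (w : {ffun 'I_n -> Bty}) : R * R :=
  (\sum_(i < n) b2R R (w i).1 / 2 ^+ i.+1, \sum_(i < n) b2R R (w i).2 / 2 ^+ i.+1).

Definition piInf (R : realType) (w : nat -> Bty) : R * R :=
  (limn (fun N : nat => \sum_(i < N) b2R R (w i).1 / 2 ^+ i.+1),
   limn (fun N : nat => \sum_(i < N) b2R R (w i).2 / 2 ^+ i.+1)).

Definition lpq (R : realType) (p q : nat) : set (R * R) :=
  [set xy | exists x' y' : R,
      (exists m : int, xy.1 - x' = m%:~R) /\ (exists k : int, xy.2 - y' = k%:~R) /\
      (p%:R / q%:R) * x' = y'].

Definition XN (R : realType) (p q : nat) : set (nat -> Bty) :=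
  [set w | lpq R p q (piInf R w)].

Definition cyl (R : realType) (p q : nat) {n : nat} (x : {ffun 'I_n -> Bty}) : set (nat -> Bty) :=
  [set w | XN R p q w /\ forall i : 'I_n, w i = x i].

Definition birk (R : realType) (n : nat) (w : nat -> Bty) : R :=
  \sum_(j < n) phi R (fun k => w (j + k)%N).

Definition Zn (R : realType) (p q n : nat) : R :=
  \sum_(x : {ffun 'I_n -> Bty} | `[< lpq R p q (piFin R x) >])
     expR (sup [set birk R n w | w in cyl R p q x]).

Definition pressure (R : realType) (p q : nat) : R :=
  limn (fun n : nat => (n%:R)^-1 * ln (Zn R p q n)).

(* Main.v *)
(* The four matrices are the transfer matrices of binary carrying: writing a
   difference of two words over D as a signed binary expansion with vector digits
   and normalising it modulo 1, the entry (k, i) of A_z counts the pairs of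
   symbols that turn the incoming carry i into the outgoing carry k and leave the
   binary digit z.  Hence (1,1,1,1) A_{x_1} ... A_{x_n} e_j, summed over the words
   x of X^n, counts the pairs of words whose scaled values differ by a constant
   t_j modulo 2^n.  For j = (0,0) one has t_j = 0, and this bounds N_n from above;
   conversely, each count is at most a constant times N_n, because the scaled
   values are O(2^n) and the number of pairs with a prescribed difference is at
   most the number of pairs with equal values.
   On the other side, two consecutive matrices always have a positive row in their
   product, so the ratios in the definition of phi converge and Birkhoff sums
   telescope: exp (S_n phi (w)) lies below the sum over j of
   (1,1,1,1) A_{w_1} ... A_{w_n} e_j, and equals the term j = (0,0) when w ends
   in zeros.  So the partition sums of the pressure agree with the number of
   coincidences up to a constant factor, and the latter is supermultiplicative:
   both limits exist, by Fekete's lemma.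
   When p = q the set D has only two elements, so the symbols 0, 1, p/q are kept
   formally distinct, as option bool. *)
Require Import Defs.
From HB Require Import structures.
From mathcomp Require Import all_boot all_order all_algebra.
From mathcomp Require Import all_classical all_reals all_analysis.
From mathcomp Require Import ring lra zify.
Import Order.TTheory GRing.Theory Num.Theory.
Import numFieldNormedType.Exports.
Local Open Scope ring_scope.

(** * Words over a finite alphabet and their dyadic values *)

(** Words are finite functions, values and matrix products are folds over lists; summing a function
    of [codom x] allows induction on the last letter. *)
Lemma big_words0 (M : nmodType) (T : finType) (F : seq T -> M) :
  \sum_(x : {ffun 'I_0 -> T}) F (codom x) = F [::].
Proof.
have x0 : {ffun 'I_0 -> T} by apply: finfun => -[].
rewrite (big_pred1 x0) => [|x].
  by congr F; apply: size0nil; rewrite size_codom card_ord.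
by symmetry; apply/eqP/ffunP => -[].
Qed.

Lemma big_wordsS (M : nmodType) (T : finType) n (F : seq T -> M) :
  \sum_(x : {ffun 'I_n.+1 -> T}) F (codom x) =
  \sum_(x : {ffun 'I_n -> T}) \sum_z F (rcons (codom x) z).
Proof.
rewrite pair_bigA /=.
pose ext (xz : {ffun 'I_n -> T} * T) : {ffun 'I_n.+1 -> T} :=
  [ffun i => if unlift ord_max i is Some k then xz.1 k else xz.2].
pose res (x : {ffun 'I_n.+1 -> T}) : {ffun 'I_n -> T} * T :=
  ([ffun k => x (lift ord_max k)], x ord_max).
rewrite (reindex ext) /=; last first.
  exists res => [[x z] _|x _].
    rewrite /res /ext /= ffunE unlift_none; congr pair.
    by apply/ffunP => k; rewrite !ffunE liftK.
  by apply/ffunP => i; rewrite !ffunE; case: unliftP => [k ->|->] /=; rewrite ?ffunE.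
apply: eq_bigr => -[x z] _ /=; congr F.
rewrite !codomE enum_ordSr map_rcons -map_comp ffunE unlift_none; congr rcons.
apply: eq_map => k /=; rewrite ffunE.
have -> : widen_ord (leqnSn n) k = lift ord_max k by apply: val_inj; apply: esym (lift_max k).
by rewrite liftK.
Qed.

Lemma big_words_cat (M : nmodType) (T : finType) m n (F : seq T -> M) :
  \sum_(x : {ffun 'I_(m + n) -> T}) F (codom x) =
  \sum_(x : {ffun 'I_m -> T}) \sum_(y : {ffun 'I_n -> T}) F (codom x ++ codom y).
Proof.
elim: n F => [|n IHn] F.
  rewrite addn0; apply: eq_bigr => x _.
  by rewrite (big_words0 _ _ (fun s => F (codom x ++ s))) cats0.
rewrite addnS big_wordsS (IHn (fun s => \sum_z F (rcons s z))).
apply: eq_bigr => x _; rewrite (big_wordsS _ _ _ (fun s => F (codom x ++ s))).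
by apply: eq_bigr => y _; apply: eq_bigr => z _; rewrite rcons_cat.
Qed.

(** Horner evaluation, most significant digit first: 2^n times the dyadic sum of a word of length n,
    hence an integer for integer digits. *)
Definition dyval (F : pzRingType) (s : seq F) : F :=
  foldl (fun a e => a * 2 + e) 0 s.
Arguments dyval {F}.

Lemma dyval_rcons (F : pzRingType) (s : seq F) e :
  dyval (rcons s e) = dyval s * 2 + e.
Proof. by rewrite /dyval foldl_rcons. Qed.

Lemma dyval_cat (F : comPzRingType) (s t : seq F) :
  dyval (s ++ t) = dyval s * 2 ^+ size t + dyval t.
Proof.
elim/last_ind: t => [|t e IHt]; first by rewrite cats0 /= mulr1 addr0.
by rewrite -rcons_cat !dyval_rcons IHt size_rcons exprSr; ring.
Qed.

Lemma dyval_map (F G : pzRingType) (g : {rmorphism F -> G}) (s : seq F) :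
  dyval (map g s) = g (dyval s).
Proof.
elim/last_ind: s => [|s e IHs]; first by rewrite /dyval /= rmorph0.
by rewrite map_rcons !dyval_rcons IHs rmorphD rmorphM rmorph_nat.
Qed.

Lemma dyval_lin (F : comPzRingType) (T : Type) (c d : F) (f g : T -> F) s :
  dyval [seq c * f x + d * g x | x <- s] =
  c * dyval (map f s) + d * dyval (map g s).
Proof.
elim/last_ind: s => [|s e IHs]; first by rewrite /dyval /=; ring.
by rewrite !map_rcons !dyval_rcons IHs; ring.
Qed.

Lemma dyval_ge0 (F : numDomainType) (s : seq F) :
  all (fun e => 0 <= e) s -> 0 <= dyval s.
Proof.
elim/last_ind: s => [|s e IHs] //; rewrite all_rcons dyval_rcons => /andP[e0 /IHs s0].
by rewrite addr_ge0 // mulr_ge0.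
Qed.

Lemma dyval_le (F : numDomainType) (c : F) (s : seq F) :
  all (fun e => e <= c) s -> dyval s <= c * (2 ^+ size s - 1).
Proof.
elim/last_ind: s => [|s e IHs]; first by rewrite /dyval /= subrr mulr0.
rewrite all_rcons dyval_rcons size_rcons => /andP[ec /IHs s0].
have -> : c * (2 ^+ (size s).+1 - 1) = c * (2 ^+ size s - 1) * 2 + c by rewrite exprSr; ring.
by rewrite lerD // ler_wpM2r.
Qed.

Lemma sum_dyadic (F : numFieldType) n (f : 'I_n -> F) :
  \sum_(i < n) f i / 2 ^+ i.+1 = dyval (codom f) / 2 ^+ n.
Proof.
have E : forall s : seq F,
    \sum_(i < size s) s`_i / 2 ^+ i.+1 = dyval s / 2 ^+ size s.
  elim/last_ind => [|s e IHs]; first by rewrite big_ord0 /dyval /= mul0r.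
  rewrite size_rcons big_ord_recr /= nth_rcons ltnn eqxx dyval_rcons mulrDl; congr (_ + _).
    transitivity (\sum_(i < size s) s`_i / 2 ^+ i.+1).
      by apply: eq_bigr => i _; rewrite nth_rcons ltn_ord.
    rewrite IHs exprSr; field.
    by rewrite expf_neq0 ?pnatr_eq0.
have := E (codom f); rewrite size_codom card_ord => <-.
apply: eq_bigr => i _; congr (_ / _).
have := nth_codom 0 f (enum_rank i); rewrite enum_rankK => <-.
by rewrite enum_rank_ord.
Qed.

(** * Carries *)

Definition Aentry (z i j : Bty) : nat :=
  nth 0%N (nth [::] (Arows z) (Bidx i)) (Bidx j).

Definition row_step (R : pzSemiRingType) (v : Bty -> R) (z j : Bty) : R :=
  \sum_i v i * (Aentry z i j)%:R.

Definition row_prod (R : pzSemiRingType) (v : Bty -> R) (s : seq Bty) : Bty -> R :=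
  foldl (row_step R) v s.
Arguments row_prod {R}.

Lemma big_Bty (M : nmodType) (F : Bty -> M) :
  \sum_b F b = F (false, false) + F (true, false) + F (false, true) + F (true, true).
Proof.
transitivity (\sum_b1 \sum_b2 F (b1, b2)).
  by rewrite pair_bigA; apply: eq_bigr => -[].
by rewrite !big_bool /= (AC (2*2) (4*2*3*1)).
Qed.

Lemma row_prod_rcons (R : pzSemiRingType) (v : Bty -> R) s z j :
  row_prod v (rcons s z) j = \sum_i row_prod v s i * (Aentry z i j)%:R.
Proof. by rewrite /row_prod foldl_rcons. Qed.

Lemma row_prod_sum (R : pzSemiRingType) (I : finType) (v : I -> Bty -> R) s j :
  row_prod (fun i => \sum_k v k i) s j = \sum_k row_prod (v k) s j.
Proof.
elim/last_ind: s j => [|s z IHs] j //.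
rewrite row_prod_rcons; under [RHS]eq_bigr do rewrite row_prod_rcons.
rewrite exchange_big /=; apply: eq_bigr => i _.
by rewrite IHs mulr_suml.
Qed.

(* Digits of the three symbols, as vectors (x, y) on which p x - q y takes the
   values 0, p, q; pairwise differences are exactly the vectors weighted by the
   matrices. *)
Definition symx (a : option bool) : int := (a == Some true)%:Z.
Definition symy (a : option bool) : int := - (a == Some false)%:Z.
Definition bit (b : bool) : int := (b : nat)%:Z.

(** A finite check. As [G] is arbitrary, for each incoming carry [j] the nine differences of symbols
    are the vectors z + j - 2 i, with column [j] of A_z as multiplicities. *)
Lemma carry_step (R : realType) (G : int -> int -> R) (j : Bty) :
  \sum_a \sum_b G (symx a - symx b) (symy a - symy b) =
  \sum_z \sum_i (Aentry z i j)%:R *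
     G (bit z.1 + bit j.1 - 2 * bit i.1) (bit z.2 + bit j.2 - 2 * bit i.2).
Proof.
have big_opt (F : option bool -> R) : \sum_a F a = F None + (F (Some true) + F (Some false)).
  rewrite (bigD1 None) //=; congr (_ + _); rewrite (bigD1 (Some true)) //=; congr (_ + _).
  by rewrite (bigD1 (Some false)) //= big1 ?addr0 // => -[[]|].
rewrite big_opt !{1}big_opt !big_Bty /symx /symy /bit /Aentry /=.
by case: j => -[] [] /=;
   rewrite ?(mul0r, add0r, addr0, subr0, mulr0, mulr1, oppr0, opprK, mul1r, sub0r, subrr);
   rewrite (_ : 1%Z - 2 = - 1%Z) //; ring.
Qed.

Lemma exchange_big4 (M : nmodType) (I J K L : finType) (F : I -> J -> K -> L -> M) :
  \sum_i \sum_j \sum_k \sum_l F i j k l = \sum_k \sum_l \sum_i \sum_j F i j k l.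
Proof.
under eq_bigr do rewrite exchange_big /=.
rewrite exchange_big /=; apply: eq_bigr => k _.
by under eq_bigr do rewrite exchange_big /=; rewrite exchange_big.
Qed.

(** The unit row at [k]: [row_prod (delta R k) s j] is the entry (k, j) of the matrix product along
    [s]. *)
Definition delta (R : pzSemiRingType) (k i : Bty) : R := (i == k)%:R.

(* A difference c of two digits is read as c = z + i - 2 k, with z a binary
   digit, i the carry coming from the right and k the carry going out; the
   matrix entry (k, i) of A_z is the number of pairs of symbols with that
   difference. *)
Lemma carry_words (R : realType) n (F : int -> int -> R) (j : Bty) :
  \sum_(a : {ffun 'I_n -> option bool}) \sum_(b : {ffun 'I_n -> option bool})
    F (dyval (map symx (codom a)) - dyval (map symx (codom b)))
      (dyval (map symy (codom a)) - dyval (map symy (codom b))) =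
  \sum_(x : {ffun 'I_n -> Bty}) \sum_k row_prod (delta R k) (codom x) j *
    F (dyval [seq bit z.1 | z <- codom x] + bit j.1 - 2 ^+ n * bit k.1)
      (dyval [seq bit z.2 | z <- codom x] + bit j.2 - 2 ^+ n * bit k.2).
Proof.
elim: n F j => [|n IHn] F j.
  rewrite (big_words0 _ _ (fun s => \sum_(b : {ffun 'I_0 -> option bool})
    F (dyval (map symx s) - dyval (map symx (codom b)))
      (dyval (map symy s) - dyval (map symy (codom b))))).
  rewrite (big_words0 _ _ (fun t => F (dyval (map symx [::]) - dyval (map symx t))
      (dyval (map symy [::]) - dyval (map symy t)))).
  rewrite (big_words0 _ _ (fun s => \sum_k row_prod (delta R k) s j *
    F (dyval [seq bit z.1 | z <- s] + bit j.1 - 2 ^+ 0 * bit k.1)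
      (dyval [seq bit z.2 | z <- s] + bit j.2 - 2 ^+ 0 * bit k.2))).
  rewrite (bigD1 j) //= big1 ?addr0 => [|k kj]; last first.
    by rewrite /row_prod /= /delta eq_sym (negbTE kj) mul0r.
  rewrite /row_prod /= /delta eqxx /dyval /= mul1r expr0; congr F; ring.
pose LF s t := F (dyval (map symx s) - dyval (map symx t))
      (dyval (map symy s) - dyval (map symy t)).
rewrite (big_wordsS _ _ _ (fun s => \sum_(b : {ffun 'I_n.+1 -> option bool}) LF s (codom b))).
under eq_bigr => a _ do under eq_bigr => al _ do
  rewrite (big_wordsS _ _ _ (fun t => LF (rcons (codom a) al) t)).
rewrite (big_wordsS _ _ _ (fun s => \sum_k row_prod (delta R k) s j *
    F (dyval [seq bit z.1 | z <- s] + bit j.1 - 2 ^+ n.+1 * bit k.1)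
      (dyval [seq bit z.2 | z <- s] + bit j.2 - 2 ^+ n.+1 * bit k.2))).
under eq_bigr => a _ do rewrite exchange_big /=.
rewrite exchange_big4.

pose G := fun d1 d2 : int => \sum_(x : {ffun 'I_n -> option bool})
  \sum_(y : {ffun 'I_n -> option bool})
    F ((dyval (map symx (codom x)) - dyval (map symx (codom y))) * 2 + d1)
      ((dyval (map symy (codom x)) - dyval (map symy (codom y))) * 2 + d2).
transitivity (\sum_al \sum_be G (symx al - symx be) (symy al - symy be)).
  apply: eq_bigr => al _; apply: eq_bigr => be _; apply: eq_bigr => x _; apply: eq_bigr => y _.
  by rewrite /LF !map_rcons !dyval_rcons; congr F; ring.
rewrite (carry_step R G j) [RHS]exchange_big /=; apply: eq_bigr => z _.
transitivity (\sum_i \sum_(x : {ffun 'I_n -> Bty}) \sum_k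
   row_prod (delta R k) (codom x) i * (Aentry z i j)%:R *
   F (dyval [seq bit z.1 | z <- rcons (codom x) z] + bit j.1 - 2 ^+ n.+1 * bit k.1)
     (dyval [seq bit z.2 | z <- rcons (codom x) z] + bit j.2 - 2 ^+ n.+1 * bit k.2)).
  apply: eq_bigr => i _.
  (* The carry [i] entering the prefix contributes 2 i once the prefix is doubled, which cancels the
     -2 i of the last digit. *)
  rewrite /G (IHn (fun e1 e2 => F (e1 * 2 + (bit z.1 + bit j.1 - 2 * bit i.1))
    (e2 * 2 + (bit z.2 + bit j.2 - 2 * bit i.2))) i).
  rewrite mulr_sumr; apply: eq_bigr => x _; rewrite mulr_sumr; apply: eq_bigr => k _.
  rewrite mulrA (mulrC (Aentry _ _ _)%:R); congr (_ * _).
  by rewrite !map_rcons !dyval_rcons exprS; congr F; ring.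
rewrite exchange_big /=; apply: eq_bigr => x _; rewrite exchange_big /=.
by apply: eq_bigr => k _; rewrite row_prod_rcons mulr_suml.
Qed.

(** * Counting coincidences *)

(* AM-GM on the fibre sizes. *)
Lemma coincidences_le (A : finType) (I : eqType) (f h : A -> I) :
  (2 * \sum_a \sum_b (f a == h b) <=
   \sum_a \sum_b (f a == f b) + \sum_a \sum_b (h a == h b))%N.
Proof.
pose s := undup (codom f ++ codom h).
have us : uniq s by rewrite undup_uniq.
have fs a : f a \in s by rewrite mem_undup mem_cat codom_f.
have hs a : h a \in s by rewrite mem_undup mem_cat codom_f orbT.
have split (g k : A -> I) : (forall a, g a \in s) ->
    (\sum_a \sum_b (g a == k b) =
     \sum_(r <- s) (\sum_a (g a == r)) * (\sum_b (k b == r)))%N.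
  move=> gs; under [RHS]eq_bigr do rewrite big_distrlr /=.
  rewrite [RHS]exchange_big /=; apply: eq_bigr => a _.
  rewrite [RHS]exchange_big /=; apply: eq_bigr => b _.
  rewrite (bigD1_seq (g a)) //= eqxx mul1n big1 ?addn0 1?eq_sym // => r.
  by rewrite eq_sym => /negbTE ->.
rewrite !split // big_distrr -big_split /=; apply: leq_sum => r _.
by rewrite !mulnn; exact: nat_Cauchy.
Qed.

(** Apply the previous bound to [f] and its translate, which has as many self-coincidences as
    [f]. *)
Lemma coincidences_shift_le (A : finType) (f : A -> int) (c : int) :
  (\sum_a \sum_b (f a == f b + c)%R <= \sum_a \sum_b (f a == f b))%N.
Proof.
have := coincidences_le A _ f (fun b => f b + c).
have -> : (\sum_a \sum_b (f a + c == f b + c)%R = \sum_a \sum_b (f a == f b))%N.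
  by apply: eq_bigr => a _; apply: eq_bigr => b _; rewrite (inj_eq (addIr c)).
by lia.
Qed.

(** The quantity f a - f b - t is at most 2 q N in absolute value, so it can only be one of 4 q + 1
    multiples of N, each prescribing a translate of [f]. *)
Lemma coincidences_mod_le (A : finType) (f : A -> int) (N t : int) (q : nat) :
  0 < N -> (forall a, 0 <= f a <= q%:Z * N) -> `|t| <= q%:Z * N ->
  (\sum_a \sum_b (N %| (f a - f b - t)%R)%Z <=
   (4 * q).+1 * \sum_a \sum_b (f a == f b))%N.
Proof.
move=> N0 fb tb.
have -> : ((4 * q).+1 * \sum_a \sum_b (f a == f b) =
    \sum_(m < (4 * q).+1) \sum_a \sum_b (f a == f b))%N.
  by rewrite sum_nat_const card_ord.
pose c (m : 'I_(4 * q).+1) : int := t + (m%:Z - (2 * q)%N%:Z) * N.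
apply: (@leq_trans (\sum_(m < (4 * q).+1) \sum_a \sum_b (f a == f b + c m)%R)); last first.
  by apply: leq_sum => m _; exact: coincidences_shift_le.
rewrite [leqRHS]exchange_big /=; apply: leq_sum => a _.
rewrite [leqRHS]exchange_big /=; apply: leq_sum => b _.
case: (boolP (N %| _)%Z) => // /dvdzP[k Ek].
have kb : - (2 * q)%N%:Z <= k <= (2 * q)%N%:Z.
  move: (fb a) (fb b) tb => /andP[a0 a1] /andP[b0 b1]; rewrite ler_norml => /andP[t0 t1].
  apply/andP; split; rewrite -(ler_pM2r N0) -?Ek PoszM; lia.
have km : (absz (k + (2 * q)%N%:Z)%R < (4 * q).+1)%N by lia.
rewrite (bigD1 (Ordinal km)) //= (_ : f a == _) // /c /=.
have -> : (absz (k + (2 * q)%N%:Z)%R)%:Z - (2 * q)%N%:Z = k by lia.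
by rewrite -Ek; apply/eqP; ring.
Qed.

Definition coincidences (F : pzRingType) (T : finType) (v : T -> F) (n : nat) : nat :=
  (\sum_(a : {ffun 'I_n -> T}) \sum_(b : {ffun 'I_n -> T})
    (dyval (map v (codom a)) == dyval (map v (codom b))))%N.
Arguments coincidences {F T}.

Lemma coincidences_supermul (F : comPzRingType) (T : finType) (v : T -> F) m n :
  (coincidences v m * coincidences v n <= coincidences v (m + n))%N.
Proof.
pose c s t : nat := dyval (map v s) == dyval (map v t).
have E : coincidences v (m + n) =
  (\sum_(a1 : {ffun 'I_m -> T}) \sum_(a2 : {ffun 'I_n -> T})
  \sum_(b1 : {ffun 'I_m -> T}) \sum_(b2 : {ffun 'I_n -> T})
    c (codom a1 ++ codom a2) (codom b1 ++ codom b2))%N.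
  rewrite /coincidences (big_words_cat _ _ _ _ (fun s =>
    \sum_(b : {ffun 'I_(m + n) -> T}) c s (codom b))%N).
  by apply: eq_bigr => a1 _; apply: eq_bigr => a2 _;
    rewrite (big_words_cat _ _ _ _ (c (codom a1 ++ codom a2))).
rewrite E /coincidences big_distrl /=; apply: leq_sum => a1 _.
rewrite big_distrr /=; apply: leq_sum => a2 _.
rewrite big_distrl /=; apply: leq_sum => b1 _.
rewrite big_distrr /=; apply: leq_sum => b2 _.
rewrite /c !map_cat !dyval_cat !(size_map v) !size_codom !card_ord.
by case: eqP => [->|]; case: eqP => [->|]; rewrite ?eqxx.
Qed.

Lemma coincidences_gt0 (F : pzRingType) (T : finType) (v : T -> F) n :
  (0 < #|T|)%N -> (0 < coincidences v n)%N.
Proof.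
case/card_gt0P => t0 _; pose a : {ffun 'I_n -> T} := [ffun => t0].
by rewrite /coincidences (bigD1 a) //= (bigD1 a) //= eqxx.
Qed.

Lemma coincidences_le_pow (F : pzRingType) (T : finType) (v : T -> F) n :
  (coincidences v n <= (#|T| ^ 2) ^ n)%N.
Proof.
apply: (@leq_trans (\sum_(a : {ffun 'I_n -> T}) \sum_(b : {ffun 'I_n -> T}) 1))%N.
  by apply: leq_sum => a _; apply: leq_sum => b _; exact: leq_b1.
by rewrite !sum_nat_const card_ffun card_ord muln1 -expnMn mulnn.
Qed.

Lemma coincidences_inj (F : idomainType) (G : pzRingType) (f : {rmorphism G -> F})
    (T S : finType) (v : T -> F) (w : S -> G) (c : F) (g : T -> S) n :
  c != 0 -> injective f -> injective g -> (forall t, f (w (g t)) = c * v t) ->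
  (coincidences v n <= coincidences w n)%N.
Proof.
move=> c0 finj ginj wg.
pose h (a : {ffun 'I_n -> T}) : {ffun 'I_n -> S} := [ffun i => g (a i)].
have hinj : injective h.
  by move=> a b /ffunP E; apply/ffunP => i; apply: ginj; have := E i; rewrite !ffunE.
have hv a : f (dyval (map w (codom (h a)))) = c * dyval (map v (codom a)).
  rewrite -dyval_map.
  have -> : map f (map w (codom (h a))) = [seq c * v t + 0 * v t | t <- codom a].
    by rewrite !codomE -!map_comp; apply: eq_map => i /=; rewrite ffunE wg mul0r addr0.
  by rewrite dyval_lin mul0r addr0.
have le_im (u : {ffun 'I_n -> S} -> nat) : (\sum_a u (h a) <= \sum_b u b)%N.
  have <- : (\sum_(b in h @: [set: {ffun 'I_n -> T}]) u b = \sum_a u (h a))%N.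
    by rewrite big_imset; [apply: eq_bigl => a; rewrite inE | exact: in2W].
  rewrite [leqRHS](bigID (mem (h @: [set: {ffun 'I_n -> T}]))) /=.
  exact: leq_addr.
rewrite /coincidences; apply: leq_trans (le_im _); apply: leq_sum => a _.
apply: leq_trans (le_im _); apply: leq_sum => b _.
by rewrite -(inj_eq finj) !hv (inj_eq (mulfI c0)).
Qed.

(** * The line as a congruence modulo 2^n *)

Definition symv (p q : nat) (a : option bool) : int := p%:Z * symx a - q%:Z * symy a.

(** For [s] of length n, membership of its point in the extended line with denominators cleared; the
    equivalence is [lpq_on_line]. *)
Definition on_line (p q n : nat) (s : seq Bty) : bool :=
  ((2 ^+ n)%R %| (p%:Z * dyval [seq bit z.1 | z <- s] -
                  q%:Z * dyval [seq bit z.2 | z <- s])%R)%Z.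

Lemma dyval_symv p q s :
  dyval (map (symv p q) s) = p%:Z * dyval (map symx s) - q%:Z * dyval (map symy s).
Proof.
rewrite -mulNr -dyval_lin; congr dyval; apply: eq_map => a.
by rewrite /symv mulNr.
Qed.

(** The test function in [carry_words] is divisibility by 2^n after removing the contribution of
    [j]. Outgoing carries add multiples of 2^n, so a condition on [x] alone remains, and the unit
    rows add up to the row of ones. *)
Lemma sum_row_on_line (R : realType) p q n (j : Bty) :
  \sum_(x : {ffun 'I_n -> Bty} | on_line p q n (codom x)) row_prod (fun=> 1 : R) (codom x) j =
  (\sum_(a : {ffun 'I_n -> option bool}) \sum_(b : {ffun 'I_n -> option bool})
   ((2 ^+ n)%R %| (dyval (map (symv p q) (codom a)) - dyval (map (symv p q) (codom b)) -
     (p%:Z * bit j.1 - q%:Z * bit j.2))%R)%Z)%N%:R.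
Proof.
pose F (s t : int) : R :=
  ((2 ^+ n)%R %| (p%:Z * s - q%:Z * t - (p%:Z * bit j.1 - q%:Z * bit j.2))%R)%Z%:R.
have := carry_words R n F j.
rewrite natr_sum; under [in X in _ -> _ = X]eq_bigr do rewrite natr_sum.
have <- : \sum_(a : {ffun 'I_n -> option bool}) \sum_(b : {ffun 'I_n -> option bool})
    F (dyval (map symx (codom a)) - dyval (map symx (codom b)))
      (dyval (map symy (codom a)) - dyval (map symy (codom b))) =
  \sum_(a : {ffun 'I_n -> option bool}) \sum_(b : {ffun 'I_n -> option bool})
   ((2 ^+ n)%R %| (dyval (map (symv p q) (codom a)) - dyval (map (symv p q) (codom b)) -
     (p%:Z * bit j.1 - q%:Z * bit j.2))%R)%Z%:R.
  apply: eq_bigr => a _; apply: eq_bigr => b _; rewrite /F !dyval_symv; congr (_ %:R).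
  by congr (nat_of_bool (_ %| _)%Z); ring.
move=> ->; rewrite big_mkcond /=; apply: eq_bigr => x _.
have -> : row_prod (fun=> 1 : R) (codom x) j = \sum_k row_prod (delta R k) (codom x) j.
  rewrite -row_prod_sum; congr (row_prod _ _ _); apply: funext => i.
  by rewrite (bigD1 i) //= big1 /delta ?eqxx ?addr0 // => k; rewrite eq_sym => /negbTE ->.
have E k : F (dyval [seq bit z.1 | z <- codom x] + bit j.1 - 2 ^+ n * bit k.1)
      (dyval [seq bit z.2 | z <- codom x] + bit j.2 - 2 ^+ n * bit k.2) =
      (on_line p q n (codom x))%:R.
  rewrite /F /on_line; congr (_%:R); congr nat_of_bool.
  set X := dyval _; set Y := dyval _.
  have -> : p%:Z * (X + bit j.1 - 2 ^+ n * bit k.1) - q%:Z * (Y + bit j.2 - 2 ^+ n * bit k.2)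
     - (p%:Z * bit j.1 - q%:Z * bit j.2) =
     2 ^+ n * (q%:Z * bit k.2 - p%:Z * bit k.1) + (p%:Z * X - q%:Z * Y) by ring.
  by rewrite rpredDl // dvdz_mulr.
under [RHS]eq_bigr do rewrite E; rewrite -mulr_suml.
by case: (on_line _ _ _ _); rewrite ?mulr1 ?mulr0.
Qed.

Lemma sum_row_on_line_ge (R : realType) p q n :
  (coincidences (symv p q) n)%:R <=
  \sum_(x : {ffun 'I_n -> Bty} | on_line p q n (codom x))
     row_prod (fun=> 1 : R) (codom x) (false, false).
Proof.
rewrite sum_row_on_line ler_nat; apply: leq_sum => a _; apply: leq_sum => b _ /=.
by case: eqP => // ->; rewrite subrr /bit /= !mulr0 subrr dvdz0.
Qed.

(** Scaled values lie in [0, q 2^n] because p <= q, and the carry [j] contributes at most q in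
    absolute value. *)
Lemma sum_row_on_line_le (R : realType) p q n j : (p <= q)%N ->
  \sum_(x : {ffun 'I_n -> Bty} | on_line p q n (codom x)) row_prod (fun=> 1 : R) (codom x) j <=
  ((4 * q).+1 * coincidences (symv p q) n)%:R.
Proof.
move=> pq; rewrite sum_row_on_line ler_nat; apply: coincidences_mod_le.
- by rewrite exprn_gt0.
- move=> a; apply/andP; split.
    apply: dyval_ge0; apply/allP => _ /mapP[[[]|] _ ->]; rewrite /symv /symx /symy /=; lia.
  set s := map _ _; have /dyval_le : all (fun e => e <= q%:Z) s.
    by apply/allP => _ /mapP[[[]|] _ ->]; rewrite /symv /symx /symy /=; lia.
  rewrite (size_map (symv p q)) size_codom card_ord => /le_trans; apply.
  by rewrite ler_wpM2l // gerBl.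
- apply: (@le_trans _ _ q%:Z); first by rewrite /bit; case: j => -[] [] /=; lia.
  by rewrite ler_peMr // exprn_ege1.
Qed.

(** * Contraction of ratios *)

Local Open Scope classical_set_scope.

Lemma row_prod_cat (R : pzSemiRingType) (v : Bty -> R) s t :
  row_prod v (s ++ t) = row_prod (row_prod v s) t.
Proof. exact: foldl_cat. Qed.

Lemma row_prod_scale (R : comPzSemiRingType) (c : R) (v : Bty -> R) s j :
  row_prod (fun i => c * v i) s j = c * row_prod v s j.
Proof.
elim/last_ind: s j => [|s z IHs] j //; rewrite !row_prod_rcons mulr_sumr.
by apply: eq_bigr => i _; rewrite IHs mulrA.
Qed.

Lemma row_prod_le (R : numDomainType) (u v : Bty -> R) s j :
  (forall i, u i <= v i) -> row_prod u s j <= row_prod v s j.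
Proof.
move=> uv; elim/last_ind: s j => [|s z IHs] j; first exact: uv.
by rewrite !row_prod_rcons ler_sum // => i _; rewrite ler_wpM2r.
Qed.

(* The pair (1,0), (0,1). *)
Definition antipodal (i j : Bty) : bool :=
  [&& i.1 != i.2, j.1 != j.2 & i.1 != j.1].

(* A cone of positive rows preserved by all four matrices. *)
Definition balanced (R : numDomainType) (h : Bty -> R) : Prop :=
  (forall i, 0 < h i) /\ (forall i j, ~~ antipodal i j -> h i <= 3 * h j).
Arguments balanced {R}.

Lemma balanced1 (R : numDomainType) : balanced (fun=> 1 : R).
Proof. by split=> // i j _; rewrite mulr1 ler1n. Qed.

Lemma balanced_le9 (R : numDomainType) (h : Bty -> R) i j :
  balanced h -> h i <= 9 * h j.
Proof.
case=> h0 h3; have n0 k : ~~ antipodal k (false, false) && ~~ antipodal (false, false) k.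
  by case: k => -[] [].
have /andP[_ /h3 H1] := n0 j; have /andP[/h3 H2 _] := n0 i.
apply: le_trans H2 _; rewrite (_ : 9 = 3 * 3); last by rewrite -natrM.
by rewrite -mulrA ler_wpM2l.
Qed.

Lemma balanced_step (R : realDomainType) (h : Bty -> R) z :
  balanced h -> balanced (row_step R h z).
Proof.
case=> h0 h3.
have p1 := h0 (false, false); have p2 := h0 (true, false).
have p3 := h0 (false, true); have p4 := h0 (true, true).
have q12 := h3 (false, false) (true, false) isT.
have q21 := h3 (true, false) (false, false) isT.
have q13 := h3 (false, false) (false, true) isT.
have q31 := h3 (false, true) (false, false) isT.
have q14 := h3 (false, false) (true, true) isT.
have q41 := h3 (true, true) (false, false) isT.
have q24 := h3 (true, false) (true, true) isT.
have q42 := h3 (true, true) (true, false) isT.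
have q34 := h3 (false, true) (true, true) isT.
have q43 := h3 (true, true) (false, true) isT.
split=> [j|i j].
  rewrite /row_step big_Bty /Aentry.
  by case: z => -[] []; case: j => -[] [] /=; rewrite ?(mulr1, mulr0); lra.
rewrite /row_step !big_Bty /Aentry.
by case: z => -[] []; case: i => -[] []; case: j => -[] [] //= _;
  rewrite ?(mulr1, mulr0); lra.
Qed.

Lemma balanced_row_prod (R : realDomainType) (h : Bty -> R) s :
  balanced h -> balanced (row_prod h s).
Proof.
move=> bh; elim/last_ind: s => [|s z IHs] //.
by rewrite /row_prod foldl_rcons; exact: balanced_step.
Qed.

Definition Aentry2 (z1 z2 k j : Bty) : nat :=
  (\sum_i Aentry z1 k i * Aentry z2 i j)%N.

Lemma Aentry2_positive_row z1 z2 : exists k, forall j, (0 < Aentry2 z1 z2 k j)%N.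
Proof.
(* The matrices of (0,0) and (1,1) have a positive row at their own index, and the other factor
   keeps it positive. Those of (1,0) and (0,1) have none; their products have one at the repeated
   digit, or at (0,0) if the digits differ. *)
exists (if z1.1 == z1.2 then z1 else if z2.1 == z2.2 then z2
  else if z1 == z2 then z1 else (false, false)) => j.
rewrite /Aentry2 big_Bty.
by case: z1 => -[] []; case: z2 => -[] []; case: j => -[] [].
Qed.

Lemma Aentry2_column_le z1 z2 j : (\sum_k Aentry2 z1 z2 k j <= 9)%N.
Proof.
rewrite big_Bty /Aentry2 !big_Bty.
by case: z1 => -[] []; case: z2 => -[] []; case: j => -[] [].
Qed.

Lemma row_prod2 (R : pzSemiRingType) (v : Bty -> R) z1 z2 j :
  row_prod v [:: z1; z2] j = \sum_k v k * (Aentry2 z1 z2 k j)%:R.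
Proof.
rewrite /row_prod /= /row_step /=; under eq_bigr do rewrite mulr_suml.
rewrite exchange_big /=; apply: eq_bigr => k _.
by rewrite natr_sum mulr_sumr; apply: eq_bigr => i _; rewrite natrM mulrA.
Qed.

(* Doeblin: a row of positive entries in the two-step matrix pulls every ratio
   v_j / h_j towards v_k / h_k. *)
Lemma ratio_contraction (R : realFieldType) (v h : Bty -> R) (a b : R) z1 z2 :
  balanced h -> (forall j, a * h j <= v j <= b * h j) ->
  exists a' b', [/\ b' - a' = (b - a) * (80 / 81) &
    forall j, a' * row_prod h [:: z1; z2] j <= row_prod v [:: z1; z2] j
              <= b' * row_prod h [:: z1; z2] j].
Proof.
move=> bh hv; have [k kP] := Aentry2_positive_row z1 z2.
have h0 := bh.1 k.
pose rho := v k / h k.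
have vk : v k = rho * h k by rewrite /rho divfK ?gt_eqF.
(* Here 81 = 9 * 9: entries of [h] agree up to a factor 9, and the columns of the two-step matrix
   sum to at most 9. *)
have hle j : row_prod h [:: z1; z2] j <= 81 * h k.
  rewrite row_prod2; apply: (@le_trans _ _ (\sum_i 9 * h k * (Aentry2 z1 z2 i j)%:R)).
    by apply: ler_sum => i _; rewrite ler_wpM2r // balanced_le9.
  rewrite -mulr_sumr -natr_sum.
  have : (\sum_i Aentry2 z1 z2 i j)%:R <= 9 :> R by rewrite ler_nat Aentry2_column_le.
  have h9 : 0 <= 9 * h k by lra.
  by move=> /(ler_wpM2l h9); lra.
have pull (g : Bty -> R) j : (forall i, 0 <= g i) -> g k <= row_prod g [:: z1; z2] j.
  move=> g0; rewrite row_prod2 (bigD1 k) //= -[leLHS]addr0 lerD //.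
    by rewrite ler_peMr // ler1n.
  by rewrite sumr_ge0 // => i _; rewrite mulr_ge0.
have /andP[ak bk] := hv k.
have arho : a <= rho by rewrite -(ler_pM2r h0) -vk.
have rhob : rho <= b by rewrite -(ler_pM2r h0) -vk.
(* The rows v - a h and b h - v are nonnegative. Their entries (rho - a) h k and (b - rho) h k at
   [k] survive in the product and exceed 1/81 of the same multiples of H, so the bracket shrinks by
   (b - a) / 81. *)
exists (a + (rho - a) / 81), (b - (b - rho) / 81); split; first by field.
move=> j; have := hle j; set H := row_prod h _ j => HH.
have lin (c d : R) : row_prod (fun i => c * v i + d * h i) [:: z1; z2] j =
    c * row_prod v [:: z1; z2] j + d * H.
  by rewrite /H !row_prod2 !mulr_sumr -big_split; apply: eq_bigr => i _ /=; ring.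
have /(pull _ j) : forall i, 0 <= 1 * v i + (- a) * h i.
  by move=> i; have /andP[? _] := hv i; lra.
have /(pull _ j) : forall i, 0 <= (-1) * v i + b * h i.
  by move=> i; have /andP[_ ?] := hv i; lra.
rewrite !lin vk.
have : (rho - a) / 81 * H <= (rho - a) * h k.
  by rewrite -mulrA ler_wpM2l ?subr_ge0 // mulrC ler_pdivrMr // mulrC.
have : (b - rho) / 81 * H <= (b - rho) * h k.
  by rewrite -mulrA ler_wpM2l ?subr_ge0 // mulrC ler_pdivrMr // mulrC.
by move=> *; apply/andP; split; lra.
Qed.

(** * Birkhoff sums of phi *)

Lemma mkseq_addn (T : Type) (w : nat -> T) m n :
  mkseq w (m + n) = mkseq w m ++ mkseq (fun k => w (m + k)%N) n.
Proof. by rewrite /mkseq iotaD map_cat add0n -{2}[m]addn0 iotaDl -map_comp. Qed.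

Lemma row_prod_bracket (R : numDomainType) (v h : Bty -> R) (a b : R) s j :
  (forall i, a * h i <= v i <= b * h i) ->
  a * row_prod h s j <= row_prod v s j <= b * row_prod h s j.
Proof.
move=> vh; rewrite -!row_prod_scale.
by apply/andP; split; apply: row_prod_le => i; have /andP[] := vh i.
Qed.

(** One contraction for every two letters; later letters keep the bracket because the matrices are
    nonnegative. *)
Lemma ratio_bracket (R : realFieldType) (v h : Bty -> R) (a b : R) (z : nat -> Bty) k :
  balanced h -> (forall i, a * h i <= v i <= b * h i) ->
  exists a' b', b' - a' = (b - a) * (80 / 81) ^+ k /\
    forall N j, (k * 2 <= N)%N ->
      a' * row_prod h (mkseq z N) j <= row_prod v (mkseq z N) j
        <= b' * row_prod h (mkseq z N) j.
Proof.
move=> bh vh; elim: k => [|k [a' [b' [wab IHk]]]].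
  by exists a, b; rewrite expr0 mulr1; split=> // N j _; exact: row_prod_bracket.
have [a'' [b'' [wab' Hk]]] := ratio_contraction _ _ _ a' b' (z (k * 2)%N) (z (k * 2).+1)
  (balanced_row_prod _ _ (mkseq z (k * 2)) bh) (fun j => IHk _ j (leqnn _)).
exists a'', b''; rewrite wab' wab -mulrA -exprSr; split=> // N j leN.
rewrite -(subnKC leN) mkseq_addn !row_prod_cat; apply: row_prod_bracket => i.
have := Hk i; rewrite -!row_prod_cat.
by rewrite mulSn add2n !mkseqS -!cats1 -catA.
Qed.

Lemma ratio_cvg (R : realType) (v h : Bty -> R) (a b : R) (z : nat -> Bty) j :
  balanced h -> (forall i, a * h i <= v i <= b * h i) ->
  cvgn (fun N => row_prod v (mkseq z N) j / row_prod h (mkseq z N) j).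
Proof.
move=> bh vh; apply/cauchy_cvgP; apply: cauchy_exP => e e0.
have q1 : `|80 / 81 : R| < 1 by rewrite ger0_norm; lra.
have /cvgrPdist_lt/(_ _ e0)[k _ /(_ k (leqnn k))] := cvg_geometric (b - a) q1.
rewrite /geometric /= sub0r normrN => ke.
have [a' [b' [wab Hk]]] := ratio_bracket _ _ _ _ _ z k bh vh.
exists a'; exists (k * 2)%N => // N /= /(Hk _ j).
have h0 : 0 < row_prod h (mkseq z N) j by exact: (balanced_row_prod _ _ _ bh).1.
rewrite -(ler_pdivlMr _ _ h0) -(ler_pdivrMr _ _ h0) => /andP[r0 r1].
rewrite /ball /= distrC ger0_norm ?subr_ge0 //.
by apply: le_lt_trans (le_lt_trans (ler_norm _) ke); rewrite -wab lerB.
Qed.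

Lemma Mprod_row_prod (R : realType) (z : nat -> Bty) n :
  Mprod R z n = row_prod (fun=> 1) (mkseq z n) (false, false).
Proof.
have big_I4 (F : 'I_4 -> R) : \sum_i F i = \sum_b F (inord (Bidx b)).
  rewrite big_Bty !big_ord_recl big_ord0 addr0 !addrA.
  by congr (F _ + F _ + F _ + F _); apply: val_inj; rewrite /= inordK.
have E b : ((const_mx 1 : 'rV[R]_4) *m \prod_(i < n) Amat R (z i)) 0 (inord (Bidx b)) =
    row_prod (fun=> 1) (mkseq z n) b.
  elim: n b => [|n IHn] b; first by rewrite big_ord0 mulmx1 mxE.
  rewrite big_ord_recr mulmxA mxE big_I4 mkseqS row_prod_rcons.
  apply: eq_bigr => i _; rewrite IHn mxE /Aentry !inordK //;
    by [case: (i) => -[] []|case: (b) => -[] []].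
rewrite /Mprod mxE big_I4 (bigD1 (false, false)) //= [X in _ + X]big1 ?addr0 => [|b bN].
  by rewrite (E (false, false)) mxE inordK // eqxx mulr1.
rewrite mxE inordK; last by case: (b) => -[] [].
by case: b bN => -[] [] //= _; rewrite mulr0.
Qed.

Lemma Mprod_gt0 (R : realType) (z : nat -> Bty) n : 0 < Mprod R z n.
Proof. by rewrite Mprod_row_prod; exact: (balanced_row_prod _ _ _ (balanced1 R)).1. Qed.

Lemma row_step1_bounds (R : realType) z j :
  2 * 1 <= row_prod (fun=> 1 : R) [:: z] j <= 3 * 1.
Proof.
rewrite /row_prod /= /row_step big_Bty /Aentry.
by case: z => -[] []; case: j => -[] [] /=; lra.
Qed.

(** Numerator and denominator are row products along the same word, started at (1,1,1,1) A_{z_1} and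
    at (1,1,1,1), so [ratio_cvg] applies. The limit is at least 2, where the logarithm is
    continuous. *)
Lemma expR_phi_cvg (R : realType) (z : nat -> Bty) :
  (Mprod R z n.+1 / Mprod R (Defs.shift z) n) @[n --> \oo] --> expR (phi R z).
Proof.
pose r n := Mprod R z n.+1 / Mprod R (Defs.shift z) n.
have rE : r = fun n => row_prod (row_prod (fun=> 1) [:: z 0%N]) (mkseq (Defs.shift z) n)
    (false, false) /
    row_prod (fun=> 1) (mkseq (Defs.shift z) n) (false, false).
  apply: funext => n; rewrite /r !Mprod_row_prod -row_prod_cat.
  by congr (row_prod _ _ _ / _); rewrite -(mkseq_addn _ z 1 n).
have rc : cvgn r.
  by rewrite rE; apply: (ratio_cvg _ _ _ 2 3); [exact: balanced1|exact: row_step1_bounds].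
have l2 : 2 <= limn r.
  apply: limr_ge => //; near=> n.
  have /andP[+ _] := row_prod_bracket _ _ _ _ _ (mkseq (Defs.shift z) n) (false, false)
    (row_step1_bounds R (z 0%N)).
  rewrite -ler_pdivlMr; first by rewrite rE.
  by rewrite -Mprod_row_prod Mprod_gt0.
have l0 : 0 < limn r by lra.
have lnr : ln (Mprod R z n / Mprod R (Defs.shift z) n.-1) @[n --> \oo] --> ln (limn r).
  rewrite -(cvg_shiftS (fun n => ln (Mprod R z n / Mprod R (Defs.shift z) n.-1))) /=.
  by apply: (cvg_comp r (@ln R)) rc _; exact: continuous_ln.
have -> : phi R z = ln (limn r).
  by rewrite /phi (cvg_limn_inf_sup lnr).2.
by rewrite lnK.
Unshelve. all: by end_near. Qed.

Lemma birkS (R : realType) n w : birk R n.+1 w = phi R w + birk R n (Defs.shift w).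
Proof. by rewrite /birk big_ord_recl. Qed.

(* Telescoping: since each phi is a true limit, no subsequence has to be chosen. *)
Lemma expR_birk_cvg (R : realType) n (w : nat -> Bty) :
  (Mprod R w (n + N) / Mprod R (fun k => w (n + k)%N) N) @[N --> \oo] --> expR (birk R n w).
Proof.
elim: n w => [|n IHn] w.
  rewrite /birk big_ord0 expR0; apply: cvg_near_cst; near=> N.
  by rewrite add0n divff // gt_eqF ?Mprod_gt0.
rewrite birkS expRD.
have -> : (fun N => Mprod R w (n.+1 + N) / Mprod R (fun k => w (n.+1 + k)%N) N) =
  (fun N => (Mprod R w (N + n).+1 / Mprod R (Defs.shift w) (N + n)) *
     (Mprod R (Defs.shift w) (n + N) / Mprod R (fun k => Defs.shift w (n + k)%N) N)).
  apply: funext => N; rewrite (addnC N n) mulrA divfK //.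
  by rewrite gt_eqF ?Mprod_gt0.
apply: cvgM (IHn (Defs.shift w)).
by have := expR_phi_cvg R w; rewrite -(cvg_shiftn n).
Unshelve. all: by end_near. Qed.

(** Each entry of the row after [n] letters is at most their sum S, so the remaining letters give at
    most S times the denominator; the bound passes to the limit. *)
Lemma expR_birk_le (R : realType) n (w : nat -> Bty) :
  expR (birk R n w) <= \sum_j row_prod (fun=> 1) (mkseq w n) j.
Proof.
have birk_cvg := expR_birk_cvg R n w.
rewrite -(cvg_lim _ birk_cvg) //; apply: limr_le; first by apply/cvg_ex; exists (expR (birk R n w)).
near=> N; rewrite ler_pdivrMr ?Mprod_gt0 // !Mprod_row_prod mkseq_addn row_prod_cat.
have p0 j : 0 < row_prod (fun=> 1 : R) (mkseq w n) j.
  exact: (balanced_row_prod _ _ _ (balanced1 R)).1.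
have bounds i : 0 * 1 <= row_prod (fun=> 1 : R) (mkseq w n) i <=
    (\sum_j row_prod (fun=> 1 : R) (mkseq w n) j) * 1.
  rewrite mul0r mulr1 ltW //= (bigD1 i) //= lerDl sumr_ge0 // => j _; exact: ltW.
by have /andP[] := row_prod_bracket _ _ _ _ _
  (mkseq (fun k => w (n + k)%N) N) (false, false) bounds.
Unshelve. all: by end_near. Qed.

(** The first column of the matrix of (0,0) is 3 times a unit vector, so trailing zeros only
    contribute powers of 3. *)
Lemma row_prod_nseq00 (R : pzRingType) (v : Bty -> R) n :
  row_prod v (nseq n (false, false)) (false, false) = v (false, false) * 3 ^+ n.
Proof.
elim: n v => [|n IHn] v; first by rewrite mulr1.
rewrite -[LHS]/(row_prod (row_step R v (false, false)) (nseq n (false, false)) (false, false)).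
rewrite IHn /row_step big_Bty /Aentry /= !mulr0 !addr0 -mulrA -exprS //.
Qed.

Definition word_then0 (s : seq Bty) : nat -> Bty := nth (false, false) s.

(** For a tail of zeros the numerator is the row entry times 3^N and the denominator is 3^N, so the
    quotients are constant in N. *)
Lemma expR_birk_then0 (R : realType) (s : seq Bty) :
  expR (birk R (size s) (word_then0 s)) = row_prod (fun=> 1) s (false, false).
Proof.
rewrite -(cvg_lim _ (expR_birk_cvg R (size s) (word_then0 s))) //.
apply: lim_near_cst => //; near=> N.
rewrite !Mprod_row_prod mkseq_addn row_prod_cat /word_then0 mkseq_nth.
have -> : mkseq (fun k => nth (false, false) s (size s + k)) N = nseq N (false, false).
  apply: (@eq_from_nth _ (false, false)) => [|i]; first by rewrite size_mkseq size_nseq.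
  rewrite size_mkseq => iN.
  by rewrite nth_mkseq // nth_nseq iN nth_default // leq_addr.
by rewrite !row_prod_nseq00 mul1r mulfK // expf_neq0 // pnatr_eq0.
Unshelve. all: by end_near. Qed.

(** * Comparison of the two growth rates *)

Lemma cvg_inv_mul0 (R : realType) (c : R) : (n%:R)^-1 * c @[n --> \oo] --> (0 : R).
Proof.
rewrite -[X in _ --> X](mul0r c); apply: cvgM; last exact: cvg_cst.
by apply/gtr0_cvgV0; [near=> n; rewrite ltr0n; near: n; exact: nbhs_infty_gt|exact: cvgr_idn].
Unshelve. all: by end_near. Qed.

(** Superadditive form: the limit is the supremum of u n / n over n > 0, finite thanks to [C]. *)
Lemma fekete (R : realType) (u : nat -> R) (C : R) :
  (forall n, 0 <= u n) -> (forall m n, u m + u n <= u (m + n)%N) ->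
  (forall n, u n <= C * n%:R) -> cvgn (fun n => (n%:R)^-1 * u n).
Proof.
move=> u0 uD uC.
pose E := [set (n.+1%:R)^-1 * u n.+1 | n in [set: nat]].
have Eub : ubound E C.
  by move=> _ [n _ <-]; rewrite mulrC ler_pdivrMr.
have Esup : has_sup E by split; [exists (1%:R^-1 * u 1%N); exists 0%N|exists C].
have uM m k : k%:R * u m <= u (k * m)%N.
  elim: k => [|k IHk]; first by rewrite mul0r.
  by apply: le_trans (uD _ _); rewrite -natr1 mulrDl mul1r addrC lerD2l.
apply/cvg_ex; exists (sup E); apply/cvgrPdist_lt => e e0.
have e20 : 0 < e / 2 by rewrite divr_gt0.
have [_ [m _ <-] Hm] := sup_adherent e20 Esup.
have small : \forall n \near \oo, (n%:R)^-1 * u m.+1 < e / 2.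
  have /cvgrPdist_lt/(_ _ e20) := cvg_inv_mul0 R (u m.+1).
  apply: filterS => n; rewrite sub0r normrN ger0_norm //.
  by rewrite mulr_ge0 // invr_ge0.
near=> n.
have n0 : (0 < n)%N by near: n; exact: nbhs_infty_gt.
have nR : 0 < n%:R :> R by rewrite ltr0n.
have up : (n%:R)^-1 * u n <= sup E.
  by apply: ub_le_sup; [exists C|exists n.-1 => //; rewrite prednK].
rewrite ger0_norm ?subr_ge0 //.
suff : m.+1%:R^-1 * u m.+1 - e / 2 <= n%:R^-1 * u n.
  by move: Hm => /=; move: (sup E) (_^-1 * u m.+1) (_^-1 * u n) => s a b Hm; lra.
have sn : (n%:R)^-1 * u m.+1 < e / 2 by near: n.
apply: (@le_trans _ _ (m.+1%:R^-1 * u m.+1 - n%:R^-1 * u m.+1)).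
  by rewrite lerD2l lerN2 ltW.
(* Full blocks of length m + 1 cover at least n - (m + 1) of the n places, and the remainder is
   dropped because [u] is nonnegative. *)
have floor_le : (n%:R - m.+1%:R) * (m.+1%:R^-1 * u m.+1) <= u n.
  have lek : (n - m.+1 <= n %/ m.+1 * m.+1)%N.
    by rewrite leq_subLR addnC {1}(divn_eq n m.+1) leq_add2l ltnW // ltn_pmod.
  apply: (@le_trans _ _ ((n %/ m.+1)%:R * u m.+1)).
    rewrite mulrA ler_wpM2r // ler_pdivrMr // -natrM lerBlDr -natrD ler_nat.
    by rewrite addnC -leq_subLR.
  apply: le_trans (uM _ _) _.
  rewrite [leRHS](_ : _ = u (n %/ m.+1 * m.+1 + n %% m.+1)%N); last by rewrite -divn_eq.
  by apply: le_trans (uD _ _); rewrite lerDl.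
have -> : m.+1%:R^-1 * u m.+1 - n%:R^-1 * u m.+1 =
    n%:R^-1 * ((n%:R - m.+1%:R) * (m.+1%:R^-1 * u m.+1)).
  by field; rewrite !lt0r_neq0.
by rewrite ler_wpM2l // invr_ge0.
Unshelve. all: by end_near. Qed.

Lemma coincidences_cvg (R : realType) (F : comPzRingType) (T : finType) (v : T -> F) :
  (0 < #|T|)%N ->
  cvgn (fun n => (n%:R)^-1 * ln ((coincidences v n)%:R : R)).
Proof.
move=> T0; have c0 n : 0 < (coincidences v n)%:R :> R by rewrite ltr0n coincidences_gt0.
apply: (fekete _ _ (ln ((#|T| ^ 2)%N%:R))).
- by move=> n; rewrite ln_ge0 // ler1n coincidences_gt0.
- move=> m n; rewrite -lnM ?posrE // -natrM ler_ln ?posrE ?ler_nat //.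
    exact: coincidences_supermul.
  by rewrite ltr0n muln_gt0 !coincidences_gt0.
- move=> n; have TT : 0 < (#|T| ^ 2)%N%:R :> R by rewrite ltr0n expn_gt0 T0.
  rewrite mulr_natr -lnXn // ler_ln ?posrE ?exprn_gt0 // -natrX ler_nat.
  exact: coincidences_le_pow.
Qed.

(** * From the digits in D to formal symbols *)

Lemma NnD_coincidences p q n :
  NnD p q n = coincidences (fun d : Dty p q => ssval d) n.
Proof.
rewrite /NnD /coincidences -sum1_card pair_bigA /= big_mkcond /=.
apply: eq_bigr => -[a b] _.
have E (x : {ffun 'I_n -> Dty p q}) :
    digsum x = dyval (map (fun d : Dty p q => ssval d) (codom x)) / 2 ^+ n.
  by rewrite /digsum sum_dyadic; congr (dyval _ / _); rewrite !codomE -map_comp.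
rewrite -(inj_eq (mulIf (_ : (2%:Q ^+ n)^-1 != 0))) ?invr_neq0 ?expf_neq0 // -!E /=.
by rewrite unfold_in /in_set asboolb /=; case: eqP.
Qed.

Lemma NnD_le p q n : (0 < q)%N -> (NnD p q n <= coincidences (symv p q) n)%N.
Proof.
move=> q0; have q0Q : q%:Q != 0 by rewrite intr_eq0; lia.
(* For p = q the digit 1 is matched first and [g] misses one symbol. It is injective because the
   symbol of d determines q d. *)
pose g (d : Dty p q) : option bool :=
  if ssval d == 0 then None else if ssval d == 1 then Some false else Some true.
have gv (d : Dty p q) : ((symv p q (g d))%:~R : rat) = q%:Q * ssval d.
  rewrite /g; have [->|d0] := eqVneq (ssval d) 0.
    by rewrite /symv /symx /symy /= oppr0 !mulr0 subrr.
  have [->|d1] := eqVneq (ssval d) 1.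
    by rewrite /symv /symx /symy /= mulr0 sub0r mulrN opprK !mulr1.
  have := ssvalP d; rewrite !inE (negbTE d0) (negbTE d1) => /eqP ->.
  by rewrite /symv /symx /symy /= mulr1 oppr0 mulr0 subr0 mulrC divfK.
have ginj : injective g.
  move=> d1 d2 E; apply: val_inj; apply: (mulfI q0Q).
  by rewrite -[LHS]gv -[RHS]gv E.
rewrite NnD_coincidences.
exact: (coincidences_inj _ _ intr _ _ _ _ _ _ n q0Q intr_inj ginj gv).
Qed.

(** * The extended line, cylinders and partition sums *)

Lemma nth_codom_ord n (T : Type) (d : T) (f : 'I_n -> T) (i : 'I_n) :
  nth d (codom f) i = f i.
Proof. by rewrite codomE (nth_map i) ?size_enum_ord ?ltn_ord // nth_ord_enum. Qed.

Lemma piFin_dyval (R : realType) n (x : {ffun 'I_n -> Bty}) :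
  piFin R x = ((dyval [seq bit z.1 | z <- codom x])%:~R / 2 ^+ n,
               (dyval [seq bit z.2 | z <- codom x])%:~R / 2 ^+ n).
Proof.
rewrite /piFin !sum_dyadic -!dyval_map; congr (dyval _ / _, dyval _ / _);
by rewrite !codomE -!map_comp.
Qed.

Lemma lpq_on_line (R : realType) p q n (x : {ffun 'I_n -> Bty}) :
  (0 < q)%N -> coprime p q ->
  lpq R p q (piFin R x) <-> on_line p q n (codom x).
Proof.
move=> q0 pq; rewrite piFin_dyval /on_line.
set X := dyval _; set Y := dyval _.
have qR : q%:R != 0 :> R by rewrite pnatr_eq0 -lt0n.
have NR : 2 ^+ n != 0 :> R by rewrite expf_neq0.
split.
  case=> x' [y' [[m /= Em] [[k /= Ek] E]]].
  apply/dvdzP; exists (p%:Z * m - q%:Z * k).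
  apply: (@intr_inj R); rewrite !(rmorphB, rmorphM, rmorphXn) /= -Em -Ek -E.
  by field; apply/andP.
case/dvdzP => N EN.
(* From p X - q Y = N 2^n and u p + v q = 1, the integer N is split between the coordinates: the
   first differs from x' by N u, the second from y' by -N v. *)
have [u [v Euv]] := Bezoutz p%:Z q%:Z.
have g1 : gcdz p%:Z q%:Z = 1 by rewrite /gcdz /= (eqP pq).
pose x' : R := X%:~R / 2 ^+ n - (N * u)%:~R.
exists x', (p%:R / q%:R * x'); split; first by exists (N * u); rewrite /x' /=; ring.
split=> //; exists (- (N * v)) => /=.
have /(congr1 (fun z : int => z%:~R : R)) : p%:Z * X - q%:Z * Y =
    N * (u * p%:Z + v * q%:Z) * 2 ^+ n by rewrite Euv g1 mulr1.
rewrite !(rmorphB, rmorphM, rmorphD, rmorphXn, rmorphN) /= => EE.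
rewrite /x' rmorphM /=.
have -> : Y%:~R = (p%:R * X%:~R - N%:~R * (u%:~R * p%:R + v%:~R * q%:R) * 2 ^+ n) / q%:R :> R.
  by rewrite -EE; field.
by field; apply/andP.
Qed.

Lemma piInf_then0 (R : realType) n (x : {ffun 'I_n -> Bty}) :
  piInf R (word_then0 (codom x)) = piFin R x.
Proof.
have E (f : Bty -> R) : f (false, false) = 0 ->
    limn (fun N => \sum_(i < N) f (word_then0 (codom x) i) / 2 ^+ i.+1) =
    \sum_(i < n) f (x i) / 2 ^+ i.+1.
  move=> f0; apply: lim_near_cst => //; near=> N.
  have nN : (n <= N)%N by near: N; exact: nbhs_infty_ge.
  rewrite -(subnKC nN) big_split_ord /= [X in _ + X]big1 ?addr0 => [|i _].
    by apply: eq_bigr => i _; rewrite /word_then0 nth_codom_ord.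
  by rewrite /word_then0 nth_default ?f0 ?mul0r // size_codom card_ord leq_addr.
by rewrite /piInf /piFin (E (fun b => b2R R b.1)) // (E (fun b => b2R R b.2)).
Unshelve. all: by end_near. Qed.

Lemma cyl_then0 (R : realType) p q n (x : {ffun 'I_n -> Bty}) :
  lpq R p q (piFin R x) -> cyl R p q x (word_then0 (codom x)).
Proof.
move=> lx; split; first by rewrite /XN /= piInf_then0.
by move=> i; rewrite /word_then0 nth_codom_ord.
Qed.

Lemma mkseq_cyl (R : realType) p q n (x : {ffun 'I_n -> Bty}) w :
  cyl R p q x w -> mkseq w n = codom x.
Proof.
case=> _ wx; rewrite codomE /mkseq -val_enum_ord -map_comp.
by apply: eq_map => i /=; rewrite wx.
Qed.

(** The upper bound is uniform on the cylinder, so the supremum is a true one. The lower bound comes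
    from [x] followed by zeros, which represents the same point and so lies in the cylinder. *)
Lemma expR_sup_birk_bounds (R : realType) p q n (x : {ffun 'I_n -> Bty}) :
  lpq R p q (piFin R x) ->
  row_prod (fun=> 1) (codom x) (false, false) <=
    expR (sup [set birk R n w | w in cyl R p q x]) <=
    \sum_j row_prod (fun=> 1) (codom x) j.
Proof.
move=> lx; set B := [set _ | _ in _].
have p0 j : 0 < row_prod (fun=> 1 : R) (codom x) j.
  exact: (balanced_row_prod _ _ _ (balanced1 R)).1.
have S0 : 0 < \sum_j row_prod (fun=> 1 : R) (codom x) j.
  by rewrite (bigD1 (false, false)) //= ltr_wpDr // sumr_ge0 // => j _; exact: ltW.
have Bub : ubound B (ln (\sum_j row_prod (fun=> 1 : R) (codom x) j)).
  move=> _ [w xw <-]; rewrite -ler_expR lnK ?posrE // -(mkseq_cyl _ _ _ _ _ _ xw).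
  exact: expR_birk_le.
have Bx : B (birk R n (word_then0 (codom x))).
  by exists (word_then0 (codom x)) => //; exact: cyl_then0.
apply/andP; split.
  have <- : expR (birk R n (word_then0 (codom x))) = row_prod (fun=> 1) (codom x) (false, false).
    by rewrite -expR_birk_then0 size_codom card_ord.
  by rewrite ler_expR; apply: ub_le_sup => //;
    exists (ln (\sum_j row_prod (fun=> 1 : R) (codom x) j)).
rewrite -[leRHS]lnK ?posrE // ler_expR; apply: ge_sup => //.
by exists (birk R n (word_then0 (codom x))).
Qed.

(** The factor 4 counts the carries [j], and 4 q + 1 comes from [sum_row_on_line_le]. *)
Lemma Zn_bounds (R : realType) p q n : (0 < q)%N -> (p <= q)%N -> coprime p q ->
  (coincidences (symv p q) n)%:R <= Zn R p q n <=
    (4 * (4 * q).+1)%:R * (coincidences (symv p q) n)%:R.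
Proof.
move=> q0 pq cpq.
have Zeq : Zn R p q n = \sum_(x : {ffun 'I_n -> Bty} | on_line p q n (codom x))
    expR (sup [set birk R n w | w in cyl R p q x]).
  by apply: eq_bigl => x; apply/asboolP/idP => /lpq_on_line; apply.
have line (x : {ffun 'I_n -> Bty}) : on_line p q n (codom x) -> lpq R p q (piFin R x).
  by move=> ?; apply/lpq_on_line.
rewrite Zeq; apply/andP; split.
  apply: le_trans (sum_row_on_line_ge R p q n) _.
  by apply: ler_sum => x /line/expR_sup_birk_bounds/andP[].
apply: (@le_trans _ _ (\sum_(x : {ffun 'I_n -> Bty} | on_line p q n (codom x))
   \sum_j row_prod (fun=> 1 : R) (codom x) j)).
  by apply: ler_sum => x /line/expR_sup_birk_bounds/andP[].
rewrite exchange_big /= -natrM -mulnA natrM.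
apply: (@le_trans _ _ (\sum_(j : Bty) ((4 * q).+1 * coincidences (symv p q) n)%:R)).
  by apply: ler_sum => j _; exact: sum_row_on_line_le.
by rewrite sumr_const card_prod card_bool mulr_natl.
Qed.

Theorem theorem4p2 (R : realType) (p q : nat) :
  (0 < p)%N -> (p <= q)%N -> coprime p q ->
  ND R p q <= pressure R p q.
Proof.
move=> p0 pq cpq; have q0 : (0 < q)%N by exact: leq_trans pq.
set N := coincidences (symv p q).
have N0 n : 0 < (N n)%:R :> R by rewrite ltr0n coincidences_gt0 // card_option.
have Ncvg := coincidences_cvg R _ _ (symv p q) ltac:(by rewrite card_option).
have Dcard : (0 < #|Dty p q|)%N.
  by apply/card_gt0P; exists (SeqSub (mem_head 0 _)).
have Dcvg := coincidences_cvg R _ _ (fun d : Dty p q => ssval d) Dcard.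
pose K : R := (4 * (4 * q).+1)%:R.
have K0 : 0 < K by rewrite ltr0n.
(* A squeeze, as ln K / n tends to 0: the pressure is a true limit, equal to the growth rate for
   formal symbols. *)
have Zcvg : (n%:R)^-1 * ln (Zn R p q n) @[n --> \oo] -->
    limn (fun n => (n%:R)^-1 * ln ((N n)%:R : R)).
  apply: (@squeeze_cvgr _ _ _ _ (fun n => (n%:R)^-1 * ln ((N n)%:R : R))
    (fun n => (n%:R)^-1 * ln K + (n%:R)^-1 * ln ((N n)%:R : R))) => //; last first.
    by rewrite -[X in _ --> X]add0r; apply: cvgD => //; exact: cvg_inv_mul0.
  near=> n; have /andP[NZ ZN] := Zn_bounds R p q n q0 pq cpq.
  have Z0 := lt_le_trans (N0 n) NZ.
  rewrite -mulrDr -lnM ?posrE // !ler_wpM2l ?invr_ge0 // ler_ln ?posrE //.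
  by rewrite mulr_gt0.
rewrite /pressure (cvg_lim _ Zcvg) // /ND.
have -> : (fun n => n%:R^-1 * ln ((NnD p q n)%:R : R)) =
    (fun n => n%:R^-1 * ln ((coincidences (fun d : Dty p q => ssval d) n)%:R : R)).
  by apply: funext => n; rewrite NnD_coincidences.
apply: ler_lim => //; near=> n.
rewrite ler_wpM2l ?invr_ge0 // ler_ln ?posrE ?ltr0n ?coincidences_gt0 ?card_option //.
by rewrite ler_nat -NnD_coincidences NnD_le.
Unshelve. all: by end_near. Qed.
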